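(* Let $\mathbf{P}$ be the semigroup on $\{a,e,0\}$ whose only nonzero products are $ea=a$ and $ee=e$, and let $\mathbf{Q}$ be the semigroup on $\{b,f,0\}$ whose only nonzero products are $bf=b$ and $ff=f$. Then the semigroup $\mathbf{P}\times\mathbf{Q}$ generates a variety containing a proper $3$-nilpotent semigroup. Hence $\mathbf{P}\times\mathbf{Q}$ is inherently nondualisable.
   Context: A semigroup is $k$-nilpotent if it satisfies the law $x_1x_2\dots x_k\approx y_1y_2\dots y_k$ (equivalently, it has a zero element $0$ and every product of length $k$ equals $0$); it is proper $k$-nilpotent if it is $k$-nilpotent but not $(k-1)$-nilpotent. Semigroups are algebras with a single binary operation. Duality notions. Let $\mathbf{M}$ be a finite algebra and $\mathcal{Q}=\mathsf{ISP}(\mathbf{M})$ the quasivariety it generates (isomorphic copies of subalgebras of direct powers of $\mathbf{M}$). An alter ego $\mathbb{M}$ of $\mathbf{M}$ is a structure on the same universe $M$, carrying the discrete topology and some finitary operations, partial operations and relations, such that each $n$-ary operation is a homomorphism $\mathbf{M}^n\to\mathbf{M}$, each $n$-ary relation is a subalgebra of $\mathbf{M}^n$, and each $n$-ary partial operation is a homomorphism from a subalgebra of $\mathbf{M}^n$ into $\mathbf{M}$. Let $\mathcal{X}=\mathsf{IS_cP^+}(\mathbb{M})$ be the class of topologically and algebraically isomorphic copies of closed substructures of powers of $\mathbb{M}$ over nonempty index sets (product topology, pointwise structure). For $\mathbf{A}\in\mathcal{Q}$, $D(\mathbf{A})=\hom(\mathbf{A},\mathbf{M})$, a closed substructure of $\mathbb{M}^A$;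 for $\mathbb{A}\in\mathcal{X}$, $E(\mathbb{A})$ is the algebra of continuous homomorphisms (structure-preserving maps) $\mathbb{A}\to\mathbb{M}$, a subalgebra of $\mathbf{M}^{\mathbb{A}}$. $\mathbb{M}$ yields a duality on $\mathbf{A}$ if the (always injective) evaluation homomorphism $e:\mathbf{A}\to E(D(\mathbf{A}))$, $e_a(x)=x(a)$, is an isomorphism. $\mathbf{M}$ is dualisable (admits a natural duality) if some alter ego of $\mathbf{M}$ yields a duality on every $\mathbf{A}\in\mathcal{Q}$; otherwise it is nondualisable. A finite algebra $\mathbf{M}$ is inherently nondualisable if $\mathbf{M}\notin\mathsf{ISP}(\mathbf{N})$ for every finite dualisable algebra $\mathbf{N}$. *)

(* Defs.v *)
From HB Require Import structures.
From mathcomp Require Import all_boot.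
From mathcomp Require Import all_classical topology.

Set Implicit Arguments.
Unset Strict Implicit.
Unset Printing Implicit Defensive.

Local Open Scope classical_set_scope.
Local Open Scope group_scope.

(* Algebras are nonempty, which [magmaType] does not enforce: hence the explicit
   [inhabited] and [S !=set0] hypotheses below. *)

#[short(type="finMagmaType")]
HB.structure Definition FinMagma := {M of Magma M & Finite M}.

HB.instance Definition _ (M N : finMagmaType) := Magma.on (M * N)%type.

Definition prod_alg (I : Type) (A : I -> Type) : Type := forall i, A i.

Definition prod_alg_mul I (A : I -> magmaType) (x y : prod_alg A) : prod_alg A :=
  fun i => x i * y i.

HB.instance Definition _ (I : Type) (A : I -> magmaType) :=
  hasMul.Build (prod_alg A) (@prod_alg_mul I A).

Definition power (M : Type) (I : Type) : Type := prod_alg (fun _ : I => M).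

Definition subalgebra (M : magmaType) (S : set M) : Prop :=
  S !=set0 /\ forall x y, S x -> S y -> S (x * y).

(* "Isomorphic to a subalgebra of A" is rendered by an injective homomorphism
   into A; closure under isomorphic copies is part of [variety_hom]. *)
Record variety (K : magmaType -> Prop) : Prop := Variety {
  variety_hom : forall (A B : magmaType) (h : {multiplicative A -> B}),
    (forall y, exists x, h x = y) -> K A -> K B;
  variety_sub : forall (A B : magmaType) (h : {multiplicative B -> A}),
    inhabited B -> injective h -> K A -> K B;
  variety_prod : forall (I : Type) (A : I -> magmaType),
    (forall i, K (A i)) -> K (prod_alg A)
}.

Definition in_generated_variety (M A : magmaType) : Prop :=
  forall K, variety K -> K M -> K A.

(* [foldl *%g x s] is the product of the word x :: s, of length (size s).+1. *)
Definition nilpotent_semigroup (k : nat) (S : semigroupType) : Prop :=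
  (0 < k)%N /\ forall (x y : S) (s t : seq S),
    (size s).+1 = k -> (size t).+1 = k ->
    foldl (fun u v => u * v) x s = foldl (fun u v => u * v) y t.

Definition proper_nilpotent_semigroup (k : nat) (S : semigroupType) : Prop :=
  nilpotent_semigroup k S /\ ~ nilpotent_semigroup k.-1 S.

Definition ISP (M A : magmaType) : Prop :=
  inhabited A /\
  exists (I : Type) (h : {multiplicative A -> power M I}), injective h.

(* A partial operation is a total function together with a domain; its values
   outside the domain are never used. *)
Record partial_hom (M : magmaType) (n : nat) := PartialHom {
  pdom : set (power M 'I_n);
  pfun :> power M 'I_n -> M;
  pdom_subalgebra : subalgebra pdom;
  pfun_hom : forall u v, pdom u -> pdom v -> pfun (u * v) = pfun u * pfun v
}.

Record alter_ego (M : magmaType) := AlterEgo {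
  ops : forall n, set {multiplicative power M 'I_n -> M};
  pops : forall n, set (partial_hom M n);
  rels : forall n, set (set (power M 'I_n));
  rels_subalgebra : forall n (r : set (power M 'I_n)), rels r -> subalgebra r
}.

Definition top_power (M : choiceType) (S : Type) : topologicalType :=
  prod_topology (fun _ : S => discrete_topology M).

Section Duality.
Variable M : finMagmaType.

(* [X] is meant to be a substructure of M^S, so that the pointwise value [y] of
   a (partial) operation at a tuple [x] of its domain always exists in X. *)
Definition structure_hom (T : alter_ego M) (S : Type) (X : set (top_power M S))
    (phi : X -> M) : Prop :=
  [/\ forall n (g : {multiplicative power M 'I_n -> M}), ops T g ->
        forall (x : 'I_n -> X) (y : X),
          (forall s, set_val y s = g (fun i => set_val (x i) s)) ->
          phi y = g (fun i => phi (x i)),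
      forall n (h : partial_hom M n), pops T h ->
        forall (x : 'I_n -> X) (y : X),
          (forall s, pdom h (fun i => set_val (x i) s)) ->
          (forall s, set_val y s = h (fun i => set_val (x i) s)) ->
          pdom h (fun i => phi (x i)) /\ phi y = h (fun i => phi (x i))
    & forall n (r : set (power M 'I_n)), rels T r ->
        forall x : 'I_n -> X,
          (forall s, r (fun i => set_val (x i) s)) ->
          r (fun i => phi (x i))].

Definition dual_structure (A : magmaType) : set (top_power M A) :=
  [set x : top_power M A | forall a b : A, x (a * b) = (x a : M) * x b].
Arguments dual_structure A : clear implicits.

Definition dual_algebra (T : alter_ego M) (S : Type) (X : set (top_power M S)) :
    set (power M X) :=
  [set phi | continuous (phi : X -> discrete_topology M) /\
             structure_hom T phi].
Arguments dual_algebra T [S] X.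

Definition evaluation (A : magmaType) (a : A) : power M (dual_structure A) :=
  fun x => set_val x a.

Lemma evaluation_hom (A : magmaType) :
  {morph @evaluation A : a b / a * b}.
Proof.
move=> a b; apply: functional_extensionality_dep => x.
by case: x => x xD; rewrite /evaluation /=; move/set_mem: (xD); apply.
Qed.

HB.instance Definition _ (A : magmaType) :=
  isMultiplicative.Build A (power M (dual_structure A)) (@evaluation A) (@evaluation_hom A).

Definition yields_duality (T : alter_ego M) (A : magmaType) : Prop :=
  set_bij [set: A] (dual_algebra T (dual_structure A)) (@evaluation A).

Definition dualisable : Prop :=
  exists T : alter_ego M, forall A : magmaType, ISP M A -> yields_duality T A.

End Duality.
Arguments dual_structure : clear implicits.
Arguments dual_algebra [M] T [S] X.
Arguments evaluation M [A] a.

Definition inherently_nondualisable (M : finMagmaType) : Prop :=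
  forall N : finMagmaType, inhabited N -> dualisable N -> ~ ISP N M.

Inductive semP : Type := Pa | Pe | P0.

Definition mulP (x y : semP) : semP :=
  match x, y with
  | Pe, Pa => Pa
  | Pe, Pe => Pe
  | _, _ => P0
  end.

Definition semP_enc (x : semP) : 'I_3 :=
  match x with Pa => inord 0 | Pe => inord 1 | P0 => inord 2 end.
Definition semP_dec (i : 'I_3) : semP :=
  match val i with 0 => Pa | 1 => Pe | _ => P0 end.
Lemma semP_encK : cancel semP_enc semP_dec.
Proof. by case; rewrite /semP_dec /= inordK. Qed.
HB.instance Definition _ := Finite.copy semP (can_type semP_encK).

Lemma mulP_assoc : associative mulP. Proof. by do 3 case. Qed.
HB.instance Definition _ := isSemigroup.Build semP mulP_assoc.

Inductive semQ : Type := Qb | Qf | Q0.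

Definition mulQ (x y : semQ) : semQ :=
  match x, y with
  | Qb, Qf => Qb
  | Qf, Qf => Qf
  | _, _ => Q0
  end.

Definition semQ_enc (x : semQ) : 'I_3 :=
  match x with Qb => inord 0 | Qf => inord 1 | Q0 => inord 2 end.
Definition semQ_dec (i : 'I_3) : semQ :=
  match val i with 0 => Qb | 1 => Qf | _ => Q0 end.
Lemma semQ_encK : cancel semQ_enc semQ_dec.
Proof. by case; rewrite /semQ_dec /= inordK. Qed.
HB.instance Definition _ := Finite.copy semQ (can_type semQ_encK).

Lemma mulQ_assoc : associative mulQ. Proof. by do 3 case. Qed.
HB.instance Definition _ := isSemigroup.Build semQ mulQ_assoc.

(* Main.v *)
(* Write M for P x Q.  In a power of M take rows r_i and columns c_p, for p a pair
   of indices, with P-part e (resp. a) on a support and Q-part constantly b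
   (resp. f).  The supports are chosen so that r_i c_p is an element w_i not
   depending on p when i is not in p, and an element not depending on i when i
   is in p.  If x is a homomorphism from the algebra A so generated (together with
   the ideal of elements having a zero at the base coordinate) with x(r_i) = x(r_j)
   and x(r_k) = x(r_l), where i, j, k, l are distinct, then
   x(w_i) = x(r_i c_jl) = x(r_j c_jl) = x(r_l c_jl) = x(r_k c_jl) = x(w_k).
   Hence every homomorphism x into a finite algebra N takes a common value on all
   w_i with x(r_i) repeated.  Sending x to that value is continuous, and by the
   pigeonhole principle it agrees with an evaluation on each finite set of
   homomorphisms, so it lies in ED(A) for every alter ego of N.  Were it an
   evaluation, it would be so at the pointwise limit of the w_i, which is not in A.
   At the base coordinate A maps onto a proper 3-nilpotent semigroup. *)

Require Import Defs.
From HB Require Import structures.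
From mathcomp Require Import all_boot.
From mathcomp Require Import all_classical topology.

Set Implicit Arguments.
Unset Strict Implicit.
Unset Printing Implicit Defensive.

Local Open Scope classical_set_scope.
Local Open Scope group_scope.

(** * A criterion for nondualisability of a finite algebra *)

Lemma finite_pigeonhole (T : finType) (f : nat -> T) :
  exists i j, i <> j /\ f i = f j.
Proof.
apply: contrapT => nH.
have f_inj : injective (fun i : 'I_#|T|.+1 => f i).
  move=> i j fij; apply: val_inj; apply: contrapT => nij.
  by apply: nH; exists i, j.
by have := leq_card _ f_inj; rewrite card_ord ltnn.
Qed.

Section Criterion.
Variables (N : finMagmaType) (A : magmaType) (c w : nat -> A).

Definition repeated (x : A -> N) (i : nat) : Prop :=
  exists2 j, i <> j & x (c i) = x (c j).

Lemma exists_repeated (x : A -> N) : exists i, repeated x i.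
Proof.
by have [i [j [nij e]]] := finite_pigeonhole (x \o c); exists i, j.
Qed.

(** The default [0] is never returned, by [exists_repeated]. *)
Definition limit_value (x : A -> N) : N := x (w (xget 0%N [set i | repeated x i])).

Hypothesis repeated_eq : forall x : A -> N, dual_structure N A x ->
  forall i j, repeated x i -> repeated x j -> x (w i) = x (w j).

Lemma limit_valueE (x : A -> N) i : dual_structure N A x -> repeated x i ->
  limit_value x = x (w i).
Proof.
move=> xhom xi; apply: repeated_eq => //.
by have [j xj] := exists_repeated x; exact: (@xgetI _ _ [set i | repeated x i] j).
Qed.

(* Finitely many homomorphisms share a repeated index, where [limit_value]
   is evaluation for all of them. *)
Lemma common_repeated (I : finType) (x : I -> A -> N) :
  exists i, forall k, repeated (x k) i.
Proof.
have [i [j [nij /ffunP e]]] :=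
  finite_pigeonhole (fun i => [ffun k => x k (c i)]).
by exists i => k; exists j => //; have := e k; rewrite !ffunE.
Qed.

Lemma cylinder_nbhs (x : dual_structure N A) (a : A) :
  nbhs x [set y : dual_structure N A | set_val y a = set_val x a].
Proof.
have cont : continuous (fun y : dual_structure N A =>
    (set_val y a : discrete_topology N)).
  move=> y; apply: (@continuous_comp _ _ _ (@set_val _ (dual_structure N A))
    (fun z : top_power N A => z a : discrete_topology N)).
    exact: initial_continuous.
  exact: (@proj_continuous {classic A} (fun=> discrete_topology N) a).
have := cont x [set z | z = set_val x a]; apply.
by apply: open_nbhs_nbhs; split => //; exact: discrete_open.
Qed.

Lemma dual_structureP (x : dual_structure N A) :
  dual_structure N A (set_val x).
Proof. exact: set_valP. Qed.

Lemma limit_value_dual (T : alter_ego N) :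
  dual_algebra T (dual_structure N A) (fun x => limit_value (set_val x)).
Proof.
split.
  move=> x U /= /nbhs_singleton Ux.
  have [i xi] := exists_repeated (set_val x); case: (xi) => j nij xij.
  (* Fixing the values at [c i] and [c j] keeps [i] repeated; fixing the one at [w i] then makes the
     map locally constant. *)
  apply: filterS (filterI (cylinder_nbhs x (w i))
    (filterI (cylinder_nbhs x (c i)) (cylinder_nbhs x (c j)))).
  move=> y [/= yw [yi yj]].
  have yr : repeated (set_val y) i by exists j => //; rewrite yi yj.
  rewrite /= (limit_valueE (dual_structureP y) yr) yw.
  by rewrite -(limit_valueE (dual_structureP x) xi).
(* Each preservation condition involves finitely many homomorphisms; [option 'I_n] adds the result
   [y] to the arguments, so that one index serves all. *)
have local n (x : 'I_n -> dual_structure N A) (y : dual_structure N A) :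
    exists i, limit_value (set_val y) = set_val y (w i) /\
      (fun k => limit_value (set_val (x k))) = (fun k => set_val (x k) (w i)).
  have [i xi] := common_repeated
    (fun k : option 'I_n => set_val (if k is Some k then x k else y)).
  exists i; split; first exact: (limit_valueE (dual_structureP y) (xi None)).
  apply: functional_extensionality_dep => k.
  exact: (limit_valueE (dual_structureP _) (xi (Some k))).
split.
- by move=> n g _ x y yx; have [i [-> ->]] := local n x y; apply: yx.
- move=> n h _ x y xdom yx; have [i [-> ->]] := local n x y.
  by split; [apply: xdom | apply: yx].
- move=> n r _ x xr.
  have [i xi] := common_repeated (fun k => set_val (x k)).
  have -> : (fun k => limit_value (set_val (x k))) =
      (fun k => set_val (x k) (w i)); last exact: xr.
  apply: functional_extensionality_dep => k.
  exact: limit_valueE (dual_structureP _) (xi k).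
Qed.

Lemma nondualisable_criterion : ISP N A ->
  (forall a, exists x : A -> N, dual_structure N A x /\
     exists2 i, repeated x i & x a <> x (w i)) ->
  ~ dualisable N.
Proof.
move=> AN sep [T dualT]; have [_ _ surj] := dualT _ AN.
have [a _ ea] := surj _ (limit_value_dual T).
have [x [xhom [i xi]]] := sep a; apply.
have /(congr1 (fun f => f (exist _ x (mem_set xhom)))) := ea.
by rewrite (limit_valueE _ xi) // /evaluation; apply.
Qed.

End Criterion.

(** * The algebra generated by rows and columns *)

Definition coord : Type := option (nat + nat * nat).

(** The product of row [i] and column [p] has P-part supported on [None] and [inl i] if [i] avoids
    [p], and on [None] and [inr p] otherwise. *)
Definition row_supp (i : nat) (s : coord) : bool :=
  match s with
  | None => true
  | Some (inl k) => i == k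
  | Some (inr p) => (i == p.1) || (i == p.2)
  end.

Definition col_supp (p : nat * nat) (s : coord) : bool :=
  match s with
  | None => true
  | Some (inl i) => (i != p.1) && (i != p.2)
  | Some (inr q) => q == p
  end.

Definition PQ : finMagmaType := (semP * semQ)%type.

Definition row_elt (i : nat) : power PQ coord :=
  fun s => (if row_supp i s then Pe else P0, Qb).
Definition col_elt (p : nat * nat) : power PQ coord :=
  fun s => (if col_supp p s then Pa else P0, Qf).

Lemma row_col_mul i p s :
  (row_elt i * col_elt p) s =
  (if row_supp i s && col_supp p s then Pa else P0, Qb).
Proof.
have -> : (row_elt i * col_elt p) s = row_elt i s * col_elt p s by [].
by rewrite /row_elt /col_elt; case: (row_supp i s); case: (col_supp p s).
Qed.

Definition has_zero (z : PQ) : bool :=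
  match z with (P0, _) | (_, Q0) => true | _ => false end.

(** A product without zero component needs P-part [Pe] on the left and Q-part [Qf] on the right;
    excluding [(Pe, Qf)] fixes the other parts. *)
Lemma has_zero_mul (y z : PQ) : y <> (Pe, Qf) -> z <> (Pe, Qf) ->
  has_zero (y * z) \/ y = (Pe, Qb) /\ z = (Pa, Qf).
Proof. by case: y z => [[] []] [[] []] //; by [left | right]. Qed.

Definition witness_set : set (power PQ coord) :=
  [set x | [\/ exists i, x = row_elt i, exists p, x = col_elt p,
     exists i p, x = row_elt i * col_elt p | has_zero (x None)]].

(** Used for closure: at the base coordinate a product either gets a zero or comes from a row times
    a column. *)
Lemma witness_set_base x : witness_set x ->
  [/\ x None <> (Pe, Qf), x None = (Pe, Qb) -> exists i, x = row_elt i
    & x None = (Pa, Qf) -> exists p, x = col_elt p].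
Proof.
case=> [[i ->]|[p ->]|[i [p ->]]|]; last by case: (x None) => [[] []].
- by split=> // _; exists i.
- by split=> // _; exists p.
- by rewrite row_col_mul.
Qed.

Lemma witness_set_mul x y :
  witness_set x -> witness_set y -> witness_set (x * y).
Proof.
move=> /witness_set_base[xE xrow _] /witness_set_base[yE _ ycol].
have [z|[/xrow[i ->] /ycol[p ->]]] := has_zero_mul xE yE; first exact: Or44.
by apply: Or43; exists i, p.
Qed.

Definition witness : Type := {x : power PQ coord | witness_set x}.

Definition witness_mul (x y : witness) : witness :=
  exist _ _ (witness_set_mul (svalP x) (svalP y)).

HB.instance Definition _ := hasMul.Build witness witness_mul.

Definition witness_val (x : witness) : power PQ coord := sval x.

Lemma witness_valM : {morph witness_val : x y / x * y}.
Proof. by []. Qed.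

HB.instance Definition _ :=
  isMultiplicative.Build witness (power PQ coord) witness_val witness_valM.

Lemma witness_inj (x y : witness) : (forall s, sval x s = sval y s) -> x = y.
Proof.
case: x y => [x xW] [y yW] /= xy.
have {}xy : x = y by apply: functional_extensionality_dep.
by case: _ / xy yW => yW; congr exist; apply: Prop_irrelevance.
Qed.

Definition row (i : nat) : witness :=
  exist _ (row_elt i) (Or41 _ _ _ (ex_intro _ i erefl)).
Definition col (p : nat * nat) : witness :=
  exist _ (col_elt p) (Or42 _ _ _ (ex_intro _ p erefl)).

(* [row i * col p] depends on [i] alone as long as [i] avoids [p], and on [p]
   alone as long as [i] is a component of [p]. *)
Definition limit_seq (i : nat) : witness := row i * col (i.+1, i.+1).

Lemma sval_row_col i p s : sval (row i * col p) s =
  (if row_supp i s && col_supp p s then Pa else P0, Qb).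
Proof. exact: row_col_mul. Qed.

Lemma row_col_notin i j k : i <> j -> i <> k ->
  row i * col (j, k) = limit_seq i.
Proof.
move=> /eqP ij /eqP ik; apply: witness_inj => s; rewrite !sval_row_col.
congr (if _ then _ else _, _).
case: s => [[l|q]|] //=; first by case: eqP => //= <-; rewrite ij ik ltn_eqF.
case: (q =P (j, k)) => [->|_]; first by rewrite (negPf ij) (negPf ik).
rewrite andbF; case: (q =P (i.+1, i.+1)) => [->|_]; last by rewrite andbF.
by rewrite /= orbb ltn_eqF.
Qed.

Lemma row_col_mem j k : row j * col (j, k) = row k * col (j, k).
Proof.
apply: witness_inj => s; rewrite !sval_row_col; congr (if _ then _ else _, _).
case: s => [[l|q]|] //=.
  case: (j =P l) => [->|_] /=; first by rewrite eqxx /= ?andbF.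
  by case: (k =P l) => [->|_] //=; rewrite eqxx /= ?andbF.
by case: (q =P (j, k)) => [->|_]; rewrite ?andbF //= !eqxx orbT.
Qed.

(** * Homomorphisms into a finite algebra *)

Section Homs.
Variables (N : finMagmaType) (x : witness -> N).
Hypothesis xM : {morph x : a b / a * b}.

Lemma limit_seq_eq i j : x (row i) = x (row j) -> x (limit_seq i) = x (limit_seq j).
Proof.
(* The index [(i + j).+1] differs from both [i] and [j], so one column serves both rows. *)
have ne m n : m <> (m + n).+1 by move/eqP; rewrite ltn_eqF // ltnS leq_addr.
move=> ij; have [i' j'] := (ne i j, ne j i).
rewrite addnC in j'; rewrite -(row_col_notin i' i') -(row_col_notin j' j').
by rewrite !xM ij.
Qed.

Lemma repeated_limit_seq i k :
  repeated row x i -> repeated row x k -> x (limit_seq i) = x (limit_seq k).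
Proof.
move=> [j ij eij] [l kl ekl].
(* If the pairs [i, j] and [k, l] meet, [limit_seq_eq] suffices; otherwise column [(j, l)] avoids
   [i] and [k]. *)
have [<-|nik] := pselect (i = k); first by [].
have [il|nil] := pselect (i = l); first by rewrite il (limit_seq_eq ekl).
have [jk|njk] := pselect (j = k); first by rewrite -jk (limit_seq_eq eij).
have [jl|njl] := pselect (j = l).
  by rewrite (limit_seq_eq eij) (limit_seq_eq ekl) jl.
rewrite -(row_col_notin ij nil) -[limit_seq k](@row_col_notin _ j l) //; last first.
  by move=> kj; apply: njk.
by rewrite !xM eij -!xM row_col_mem !xM ekl.
Qed.

End Homs.

Definition limit_elt : power PQ coord :=
  fun s => (if s is None then Pa else P0, Qb).

(** The base value [(Pa, Qb)] leaves only products of a row and a column, whose P-part is nonzero at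
    a second coordinate. *)
Lemma limit_elt_notin : ~ witness_set limit_elt.
Proof.
case=> [[i /(congr1 (fun f => f None))]|[p /(congr1 (fun f => f None))]|
  [i [p E]]|] //.
have := congr1 (fun f => f (Some (inl i))) E.
have := congr1 (fun f => f (Some (inr p))) E.
rewrite !row_col_mul /= !eqxx andbT.
by case: (i =P p.1) => // ?; case: (i =P p.2).
Qed.

Lemma row_supp_eventually (s : coord) :
  exists n, forall i, (n <= i)%N -> row_supp i s = ~~ isSome s.
Proof.
case: s => [[l|q]|]; last by exists 0%N.
- by exists l.+1 => i li; rewrite /= gtn_eqF.
- exists (q.1 + q.2).+1 => i qi; rewrite /= !gtn_eqF //.
    exact: leq_ltn_trans (leq_addl _ _) qi.
  exact: leq_ltn_trans (leq_addr _ _) qi.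
Qed.

Lemma witness_ISP (N : magmaType) : ISP N PQ -> ISP N witness.
Proof.
move=> [_ [I [h h_inj]]]; split; first by constructor; exact: row 0%N.
pose f (x : witness) : power N (coord * I) := fun si => h (sval x si.1) si.2.
have fM : {morph f : x y / x * y}.
  move=> x y; apply: functional_extensionality_dep => -[s i].
  exact: (congr1 (fun g => g i) (@gmulfM _ _ h (sval x s) (sval y s))).
exists (coord * I)%type.
exists (HB.pack_for {multiplicative witness -> power N (coord * I)} f
  (isMultiplicative.Build witness (power N (coord * I)) f fM)).
move=> x y /= xy; apply: witness_inj => s; apply: h_inj.
apply: functional_extensionality_dep => i.
exact: (congr1 (fun g => g (s, i)) xy).
Qed.

Lemma PQ_inherently_nondualisable : inherently_nondualisable PQ.
Proof.
move=> N _ dualN PQN; move: (dualN); apply/(@nondualisable_criterion _ _ row limit_seq).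
- by move=> x xM i j; apply: repeated_limit_seq.
- exact: witness_ISP.
move=> a.
have [s as_] : exists s, sval a s <> limit_elt s.
  apply: contrapT => /forallNP eqa; apply: limit_elt_notin.
  suff <- : sval a = limit_elt by exact: svalP.
  by apply: functional_extensionality_dep => s; apply: contrapT; exact: eqa.
have [_ [I [h h_inj]]] := PQN.
have [k hk] : exists k, h (sval a s) k <> h (limit_elt s) k.
  apply: contrapT => /forallNP eqa; apply: as_; apply: h_inj.
  by apply: functional_extensionality_dep => k; apply: contrapT; exact: eqa.
exists (fun x => h (sval x s) k); split.
  by move=> x y; exact: (congr1 (fun g => g k) (@gmulfM _ _ h (sval x s) (sval y s))).
(* From [n] on, the rows agree at [s], so [n] is repeated, and [limit_seq n] already has the value
   of [limit_elt] there. *)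
have [n rn] := row_supp_eventually s; exists n.
  exists n.+1; first by move/eqP; rewrite ltn_eqF.
  by rewrite /= /row_elt !rn.
by rewrite sval_row_col rn //; move: hk; case: (s).
Qed.

(** * A proper 3-nilpotent quotient *)

Inductive nil3 : Type := Nu | Nv | Nuv | N0.

Definition nil3_mul (x y : nil3) : nil3 :=
  match x, y with Nu, Nv => Nuv | _, _ => N0 end.

Definition nil3_enc (x : nil3) : nat :=
  match x with Nu => 0 | Nv => 1 | Nuv => 2 | N0 => 3 end.
Definition nil3_dec (i : nat) : nil3 :=
  match i with 0 => Nu | 1 => Nv | 2 => Nuv | _ => N0 end.
Lemma nil3_encK : cancel nil3_enc nil3_dec. Proof. by case. Qed.
HB.instance Definition _ := Choice.copy nil3 (can_type nil3_encK).

Lemma nil3_mulA : associative nil3_mul. Proof. by do 3 case. Qed.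
HB.instance Definition _ := isSemigroup.Build nil3 nil3_mulA.

Lemma nil3_proper : proper_nilpotent_semigroup 3 nil3.
Proof.
split=> [|[_ /(_ Nu Nu [:: Nu] [:: Nv] erefl erefl)] //].
split=> // x y [|x1 [|x2 [|//]]] // [|y1 [|y2 [|//]]] // _ _ /=.
have nul3 (a b c : nil3) : a * b * c = N0 by case: a b c => [] [] [].
by rewrite !nul3.
Qed.

Definition nil3_of (z : PQ) : nil3 :=
  match z with
  | (Pe, Qb) => Nu | (Pa, Qf) => Nv | (Pa, Qb) => Nuv | _ => N0
  end.

(** The exclusion matters: [(Pe, Qf) * (Pa, Qf)] is [(Pa, Qf)], sent to [Nv], whereas [N0 * Nv] is
    [N0]. *)
Lemma nil3_ofM (y z : PQ) : y <> (Pe, Qf) -> z <> (Pe, Qf) ->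
  nil3_of (y * z) = nil3_of y * nil3_of z.
Proof. by case: y z => [[] []] [[] []]. Qed.

Lemma nil3_in_variety : in_generated_variety PQ nil3.
Proof.
move=> K [Khom Ksub Kprod] KPQ.
have KW : K witness.
  apply: (Ksub (power PQ coord) witness witness_val).
  - by constructor; exact: row 0%N.
  - by move=> x y xy; apply: witness_inj => s; exact: (congr1 (fun g => g s) xy).
  - by apply: Kprod.
pose f (x : witness) : nil3 := nil3_of (sval x None).
have fM : {morph f : x y / x * y}.
  move=> x y; have [xE _ _] := witness_set_base (svalP x).
  by have [yE _ _] := witness_set_base (svalP y); exact: nil3_ofM.
pose F := HB.pack_for {multiplicative witness -> nil3} f
  (isMultiplicative.Build witness nil3 f fM).
apply: (Khom witness nil3 F) KW => -[].
- by exists (row 0).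
- by exists (col (0, 0)%N).
- by exists (limit_seq 0); rewrite /= /f sval_row_col.
- by exists (row 0 * row 0).
Qed.

Theorem theorem9p1 :
  (exists S : semigroupType,
     proper_nilpotent_semigroup 3 S /\
     in_generated_variety (semP * semQ)%type S) /\
  inherently_nondualisable (semP * semQ)%type.
Proof.
split; last exact: PQ_inherently_nondualisable.
by exists nil3; split; [exact: nil3_proper | exact: nil3_in_variety].
Qed.
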